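(* Let $H$ be a Hopf algebra over $\mathbb{C}$ with a modular pair in involution $(\delta,\sigma)$, let $A$ be an algebra over $\mathbb{C}$ with an action of $H$, and let $\tau:A\to\mathbb{C}$ be a $\delta$-invariant $\sigma$-trace under the action of $H$. For $h^1,\dots,h^n\in H$ define $\gamma(h^1\otimes\cdots\otimes h^n)\in C^n(A)$ by $$\gamma(h^1\otimes\cdots\otimes h^n)(x^0,\dots,x^n)=\tau\big(x^0\,h^1(x^1)\cdots h^n(x^n)\big),\qquad x^0,\dots,x^n\in A$$ (so that in degree $0$, $\gamma(1)=\tau$). Then $\gamma$ defines a canonical map in cyclic cohomology $$HC^*_{(\delta,\sigma)}(H)\to HC^*(A).$$
   Context: Notation: $\Delta h=\sum h_{(1)}\otimes h_{(2)}$ is the coproduct, $\varepsilon$ the counit, $S$ the antipode. Modular pair in involution: a character $\delta:H\to\mathbb{C}$ (unital algebra homomorphism) and a group-like element $\sigma\in H$ with $\delta(\sigma)=1$ such that, with the twisted antipode $\widetilde S(h)=\sum\delta(h_{(1)})S(h_{(2)})$, the map $h\mapsto\sigma^{-1}\widetilde S(h)$ has square the identity of $H$. Action of $H$ on $A$: a linear map $H\otimes A\to A$, $h\otimes a\mapsto h(a)$, with $h_1(h_2(a))=(h_1h_2)(a)$ and $h(ab)=\sum h_{(1)}(a)\,h_{(2)}(b)$ for all $h,h_1,h_2\in H$, $a,b\in A$. $\sigma$-trace: a linear form $\tau$ on $A$ with $\tau(ab)=\tau(b\,\sigma(a))$ for all $a,b\in A$. It is $\delta$-invariant if $\tau(h(a)b)=\tau(a\,\widetilde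 S(h)(b))$ for all $a,b\in A$, $h\in H$. Cyclic cohomology of $H$: $HC^*_{(\delta,\sigma)}(H)$ is the cohomology of the $(b,B)$-bicomplex of the cyclic module $\{H^{\otimes n}\}_{n\ge0}$ ($H^{\otimes0}=\mathbb{C}$) with faces $\delta_i:H^{\otimes(n-1)}\to H^{\otimes n}$ given by $\delta_0(h^1\otimes\cdots\otimes h^{n-1})=1\otimes h^1\otimes\cdots\otimes h^{n-1}$, $\delta_j(h^1\otimes\cdots\otimes h^{n-1})=h^1\otimes\cdots\otimes\Delta h^j\otimes\cdots\otimes h^{n-1}$ for $1\le j\le n-1$, $\delta_n(h^1\otimes\cdots\otimes h^{n-1})=h^1\otimes\cdots\otimes h^{n-1}\otimes\sigma$; degeneracies $\sigma_i:H^{\otimes(n+1)}\to H^{\otimes n}$ ($0\le i\le n$) applying $\varepsilon$ to the $(i+1)$-st factor; and cyclic operators $\tau_n(h^1\otimes\cdots\otimes h^n)=(\Delta^{n-1}\widetilde S(h^1))\cdot(h^2\otimes\cdots\otimes h^n\otimes\sigma)$, $\tau_0=\mathrm{id}$, where $\Delta^{n-1}:H\to H^{\otimes n}$ is the iterated coproduct and $\cdot$ the product of $H^{\otimes n}$. Equivalently (the ground field being $\mathbb{C}$), it is the cohomology of the complex of cyclic elements $\{x\in H^{\otimes n}:\tau_n x=(-1)^n x\}$ with differential $b=\sum_{i=0}^{n}(-1)^i\delta_i:H^{\otimes(n-1)}\to H^{\otimes n}$. Cyclic cohomology of $A$: $C^n(A)$ is the space of $(n+1)$-linear forms on $A$,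 with $(b\varphi)(x^0,\dots,x^{n})=\sum_{i=0}^{n-1}(-1)^i\varphi(x^0,\dots,x^ix^{i+1},\dots,x^{n})+(-1)^{n}\varphi(x^{n}x^0,x^1,\dots,x^{n-1})$ for $\varphi\in C^{n-1}(A)$. $HC^*(A)$ is the cohomology of the complex of cyclic cochains, i.e. those $\varphi\in C^n(A)$ with $\varphi(x^n,x^0,\dots,x^{n-1})=(-1)^n\varphi(x^0,\dots,x^n)$, with differential $b$. The map in cyclic cohomology is the one obtained from $\gamma$ sending the complex of cyclic elements of $\{H^{\otimes n}\}$ to the complex of cyclic cochains of $A$, compatibly with the differentials $b$. *)

(* Defs.v *)
From HB Require Import structures.
From mathcomp Require Import all_boot all_order all_algebra sesquilinear.
From mathcomp Require Import boolp functions.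
From mathcomp Require Import freeg.

(* Membership in subspaces is decided classically, which provides the boolean
   predicates needed by submodClosed and by quotient types. *)

Set Implicit Arguments.
Unset Strict Implicit.
Unset Printing Implicit Defensive.

Import GRing.Theory.

Local Open Scope ring_scope.
Local Open Scope quotient_scope.

Section QuotientModule.
Variables (K : fieldType) (V : lmodType K) (I : submodClosed V).

Definition submod_pred : {pred V} := fun x => x \in I.

Fact submod_predP : submod_closed submod_pred.
Proof. by split=> [|a u v Iu Iv]; [exact: rpred0|exact/rpredD/Iv/rpredZ]. Qed.

HB.instance Definition _ := GRing.isSubmodClosed.Build K V submod_pred
  (GRing.submod_closed_semi submod_predP).

Definition lquot : Type := {ideal_quot submod_pred}.
HB.instance Definition _ := GRing.Zmodule.on lquot.

Definition qclass (x : V) : lquot := \pi_({ideal_quot submod_pred}) x.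
Definition qrepr (q : lquot) : V := repr (q : {ideal_quot submod_pred}).

Lemma qreprK : cancel qrepr qclass. Proof. exact: reprK. Qed.

Lemma qclassP x y : reflect (qclass x = qclass y) (x - y \in I).
Proof.
rewrite -[x - y \in I]/(x - y \in submod_pred) Quotient.idealrBE; exact: eqP.
Qed.

Lemma qclassD : {morph qclass : x y / x + y}.
Proof. by move=> x y; rewrite /qclass piE. Qed.

Definition qscale (a : K) (q : lquot) : lquot := qclass (a *: qrepr q).

Lemma qscale_class a x : qscale a (qclass x) = qclass (a *: x).
Proof. by apply/qclassP; rewrite -scalerBr rpredZ//; apply/qclassP/qreprK. Qed.

Fact qscaleA a b q : qscale a (qscale b q) = qscale (a * b) q.
Proof. by rewrite -(qreprK q) !qscale_class scalerA. Qed.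

Fact qscale1 : left_id 1 qscale.
Proof. by move=> q; rewrite -(qreprK q) qscale_class scale1r. Qed.

Fact qscaleDr : right_distributive qscale +%R.
Proof.
move=> a p q; rewrite -(qreprK p) -(qreprK q).
by rewrite -qclassD !qscale_class scalerDr qclassD.
Qed.

Fact qscaleDl q : {morph qscale^~ q : a b / a + b}.
Proof. by move=> a b; rewrite -(qreprK q) !qscale_class scalerDl qclassD. Qed.

HB.instance Definition _ := GRing.Zmodule_isLmodule.Build K lquot
  qscaleA qscale1 qscaleDr qscaleDl.

Fact qclass_is_linear : linear qclass.
Proof. by move=> a x y; rewrite qclassD -qscale_class. Qed.

HB.instance Definition _ := GRing.isLinear.Build K V lquot *:%R qclass
  qclass_is_linear.

End QuotientModule.

Section TensorPower.
Variables (K : fieldType) (V : lmodType K).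

(* The first n entries of s, padded by 0; only used when size s = n. *)
Definition tup n (s : seq V) : n.-tuple V := [tuple s`_k | k < n].

Definition upd n (t : n.-tuple V) (i : 'I_n) (v : V) : n.-tuple V :=
  [tuple if k == i then v else tnth t k | k < n].

Definition multilinear (W : lmodType K) n (f : n.-tuple V -> W) :=
  forall (t : n.-tuple V) (i : 'I_n), linear (fun v => f (upd t i v)).

(* The smallest subspace of the free module on V^n containing the relations of
   multilinearity, i.e. the intersection of all of them. *)
Definition mlrel n : {pred {freeg (n.-tuple V) / K}} := fun x =>
  `[< forall S : submodClosed {freeg (n.-tuple V) / K},
        (forall t i a u v,
           << upd t i (a *: u + v) >> - a *: << upd t i u >> - << upd t i v >>
             \in S) ->
        x \in S >].

Arguments mlrel n : clear implicits.

Fact mlrel_closed n : submod_closed (mlrel n).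
Proof.
split=> [|a u v /asboolP Su /asboolP Sv]; apply/asboolP => S hS.
  exact: rpred0.
by rewrite rpredD ?rpredZ ?Su ?Sv.
Qed.

HB.instance Definition _ n := GRing.isSubmodClosed.Build K _ (mlrel n)
  (GRing.submod_closed_semi (mlrel_closed n)).

(* V^{(x) n}, with V^{(x) 0} the line spanned by pure [tuple]. *)
Definition tpow n : Type := lquot (mlrel n).
HB.instance Definition _ n := GRing.Lmodule.on (tpow n).

Definition pure n (t : n.-tuple V) : tpow n := qclass (mlrel n) << t >>.

(* The linear map induced by a multilinear f, characterized by tlift_pure and
   tpow_ext. It is 0 by convention when f is not multilinear, so that tlift f
   is always linear. *)
Definition tlift (W : lmodType K) n (f : n.-tuple V -> W) (x : tpow n) : W :=
  if `[< multilinear f >] then fglift f (qrepr (x : lquot (mlrel n))) else 0.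

Fact fglift_is_linear (W : lmodType K) (T : choiceType) (f : T -> W) :
  linear (fglift f : {freeg T / K} -> W).
Proof.
pose m := GRing.isZmodMorphism.Build _ _ (fglift f) (lift_is_additive f).
pose g : {additive {freeg T / K} -> W} := HB.pack (fglift f) m.
have gU k t : g << k *g t >> = k *: f t by exact: liftU.
move=> a x y; rewrite -![fglift f _]/(g _) raddfD; congr (_ + _).
have -> : g x = \sum_(t <- dom x) coeff t x *: f t.
  by rewrite -{1}(freeg_sumE x) raddf_sum; apply: eq_bigr => t _; exact: gU.
rewrite -[a *: x]/(fgscale a x) raddf_sum scaler_sumr.
by apply: eq_bigr => t _; rewrite gU scalerA.
Qed.

HB.instance Definition _ (W : lmodType K) (T : choiceType) (f : T -> W) :=
  GRing.isLinear.Build K {freeg T / K} W *:%R (fglift f) (fglift_is_linear f).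

Definition fgker (W : lmodType K) (T : choiceType) (f : T -> W) :
  {pred {freeg T / K}} := fun x => fglift f x == 0.

Fact fgker_closed (W : lmodType K) (T : choiceType) (f : T -> W) :
  submod_closed (fgker f).
Proof.
split=> [|a u v /eqP fu /eqP fv]; apply/eqP; first exact: linear0.
by rewrite linearP/= fu fv scaler0 addr0.
Qed.

HB.instance Definition _ (W : lmodType K) (T : choiceType) (f : T -> W) :=
  GRing.isSubmodClosed.Build K _ (fgker f)
    (GRing.submod_closed_semi (fgker_closed f)).

Lemma fglift_mlrel (W : lmodType K) n (f : n.-tuple V -> W) x y :
  multilinear f -> qclass (mlrel n) x = qclass (mlrel n) y ->
  fglift f x = fglift f y.
Proof.
move=> f_ml /qclassP/asboolP/(_ (fgker f)) xy; apply/eqP.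
rewrite -subr_eq0 -linearB; apply: xy => t i a u v; apply/eqP.
by rewrite !linearB/= linearZ/= !liftU !scale1r f_ml -addrA -opprD subrr.
Qed.

Fact tlift_is_linear (W : lmodType K) n (f : n.-tuple V -> W) :
  linear (tlift f).
Proof.
move=> a x y; rewrite /tlift; case: asboolP => [f_ml|_]; last first.
  by rewrite scaler0 addr0.
rewrite -[RHS](linearP (fglift f)); apply: (fglift_mlrel f_ml).
rewrite (qclass_is_linear (mlrel n)).
by rewrite !qreprK.
Qed.

HB.instance Definition _ (W : lmodType K) n (f : n.-tuple V -> W) :=
  GRing.isLinear.Build K (tpow n) W *:%R (tlift f) (tlift_is_linear f).

Lemma pure_multilinear n : multilinear (@pure n).
Proof.
move=> t i a u v; rewrite /pure -linearP; apply/qclassP/asboolP => S hS.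
by rewrite opprD addrA hS.
Qed.

Lemma tlift_pure (W : lmodType K) n (f : n.-tuple V -> W) t :
  multilinear f -> tlift f (pure t) = f t.
Proof.
move=> f_ml; rewrite /tlift asboolT// -[RHS]scale1r -liftU.
by apply: fglift_mlrel => //; rewrite qreprK.
Qed.

Lemma tpow_ext (W : lmodType K) n (f g : {linear tpow n -> W}) :
  (forall t, f (pure t) = g (pure t)) -> f =1 g.
Proof.
move=> fg x; rewrite -(qreprK x) -(freeg_sumE (qrepr x)) !linear_sum.
apply: eq_bigr => t _; have -> : << coeff t (qrepr x) *g t >> =
    coeff t (qrepr x) *: << t >> :> {freeg (n.-tuple V) / K}.
  by apply/eqP/freeg_eqP => u; rewrite coeffZ !coeffU mul1r.
by rewrite !linearZ/= fg.
Qed.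

(* Sweedler notation: tlift2 F (Delta h) is \sum F h_(1) h_(2). *)
Definition tlift2 (W : lmodType K) (F : V -> V -> W) : tpow 2 -> W :=
  tlift (fun t : 2.-tuple V => F t`_0 t`_1).
HB.instance Definition _ (W : lmodType K) (F : V -> V -> W) :=
  GRing.Linear.on (tlift2 F).

End TensorPower.

Arguments tpow {K} V n.
Arguments pure {K V n} t.
Arguments tup {K V} n s.

Section TensorOps.
Variables (K : fieldType) (H : algType K).

Definition tmul n (x y : tpow H n) : tpow H n :=
  tlift (fun s => tlift (fun t =>
    pure [tuple tnth s i * tnth t i | i < n]) y) x.

(* id (x) ... (x) D (x) ... (x) id, with D applied to the factor of rank i,
   counted from 0. *)
Definition insert_at (D : H -> tpow H 2) n (i : nat) : tpow H n -> tpow H n.+1 :=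
  tlift (fun h : n.-tuple H => tlift (fun t : 2.-tuple H =>
    pure (tup n.+1 (take i h ++ t ++ drop i.+1 h))) (D h`_i)).
HB.instance Definition _ D n i := GRing.Linear.on (@insert_at D n i).

End TensorOps.

HB.mixin Record Algebra_isHopf (K : fieldType) H of GRing.Algebra K H := {
  comul : {linear H -> tpow H 2};
  counit : {lrmorphism H -> K^o};
  antipode : {linear H -> H};
  comul1 : comul 1 = pure [tuple 1; 1];
  comulM : forall g h, comul (g * h) = tmul (comul g) (comul h);
  comulA : forall h, insert_at comul 0 (comul h) = insert_at comul 1 (comul h);
  counitl : forall h, tlift2 (fun a b => counit a *: b) (comul h) = h;
  counitr : forall h, tlift2 (fun a b => counit b *: a) (comul h) = h;
  antipodel : forall h,
    tlift2 (fun a b => antipode a * b) (comul h) = (counit h : K) *: 1;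
  antipoder : forall h,
    tlift2 (fun a b => a * antipode b) (comul h) = (counit h : K) *: 1
}.

#[short(type="hopfAlgType")]
HB.structure Definition HopfAlgebra (K : fieldType) :=
  {H of GRing.Algebra K H & Algebra_isHopf K H}.

Section HopfTheory.
Variables (K : fieldType) (H : hopfAlgType K).

Definition grouplike (g : H) : Prop :=
  comul g = pure [tuple g; g] /\ counit g = 1.

Definition twisted_antipode (delta : {lrmorphism H -> K^o}) (h : H) : H :=
  tlift2 (fun a b => (delta a : K) *: antipode b) (comul h).

(* A group-like element is invertible; sigma_inv is the inverse of sigma, unique
   as a two-sided inverse. *)
Record modular_pair_in_involution
    (delta : {lrmorphism H -> K^o}) (sigma : H) : Prop := {
  mpi_grouplike : grouplike sigma;
  mpi_delta : delta sigma = 1;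
  mpi_involution : exists sigma_inv : H,
    [/\ sigma_inv * sigma = 1, sigma * sigma_inv = 1 &
        forall h, sigma_inv * twisted_antipode delta
          (sigma_inv * twisted_antipode delta h) = h]
}.

(* Delta^n : H -> H^{(x) n+1}. *)
Fixpoint comul_iter (n : nat) : H -> tpow H n.+1 :=
  if n is m.+1 then fun h => insert_at comul 0 (comul_iter m h)
  else fun h => pure [tuple h].

Variables (delta : {lrmorphism H -> K^o}) (sigma : H).

Definition face n (i : nat) : tpow H n -> tpow H n.+1 :=
  if i == 0%N then tlift (fun h : n.-tuple H => pure [tuple of 1 :: h])
  else if (i <= n)%N then insert_at comul i.-1
  else tlift (fun h : n.-tuple H => pure [tuple of rcons h sigma]).
Arguments face : clear implicits.

Fact face_is_linear n i : linear (face n i).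
Proof. by rewrite /face; case: ifP => _; [|case: ifP => _]; exact: linearP. Qed.
HB.instance Definition _ n i :=
  GRing.isLinear.Build K (tpow H n) (tpow H n.+1) *:%R (face n i)
    (@face_is_linear n i).

Definition hopf_b n (x : tpow H n) : tpow H n.+1 :=
  \sum_(i < n.+2) (-1) ^+ i *: face n i x.

Fact hopf_b_is_linear n : linear (@hopf_b n).
Proof.
move=> a x y; rewrite /hopf_b scaler_sumr -big_split/=; apply: eq_bigr => i _.
by rewrite linearP scalerDr !scalerA mulrC.
Qed.
HB.instance Definition _ n :=
  GRing.isLinear.Build K (tpow H n) (tpow H n.+1) *:%R (@hopf_b n)
    (@hopf_b_is_linear n).

Definition cyclic_op n : tpow H n -> tpow H n :=
  if n is m.+1 then
    tlift (fun h : m.+1.-tuple H =>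
      tmul (comul_iter m (twisted_antipode delta (thead h)))
           (pure [tuple of rcons (behead h) sigma]))
  else id.

Fact cyclic_op_is_linear n : linear (@cyclic_op n).
Proof. by case: n => [//|n]; exact: linearP. Qed.
HB.instance Definition _ n :=
  GRing.isLinear.Build K (tpow H n) (tpow H n) *:%R (@cyclic_op n)
    (@cyclic_op_is_linear n).

Definition cyclic_elt n : {pred tpow H n} :=
  fun x => cyclic_op x == (-1) ^+ n *: x.
Arguments cyclic_elt : clear implicits.

Fact cyclic_elt_closed n : submod_closed (cyclic_elt n).
Proof.
split=> [|a u v /eqP cu /eqP cv]; apply/eqP; first by rewrite linear0 scaler0.
by rewrite linearP/= cu cv scalerDr !scalerA mulrC.
Qed.
HB.instance Definition _ n := GRing.isSubmodClosed.Build K _ (cyclic_elt n)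
  (GRing.submod_closed_semi (cyclic_elt_closed n)).

End HopfTheory.

Arguments face {K H} sigma n i x.
Arguments cyclic_elt {K H} delta sigma n x.

(* Cohomology of the complex of subspaces C n of M n with differential d:
   cocycles modulo those cocycles that are d y for some y in C. The definition
   does not presuppose that d maps C to C or that d \o d = 0. *)
Section Cohomology.
Variables (K : fieldType) (M : nat -> lmodType K).
Variables (d : forall n, {linear M n -> M n.+1}).
Variables (C : forall n, submodClosed (M n)).

Definition cocycle n : {pred M n} := fun x => (x \in C n) && (d n x == 0).
Arguments cocycle : clear implicits.

Fact cocycle_closed n : submod_closed (cocycle n).
Proof.
split=> [|a u v /andP[Cu /eqP du] /andP[Cv /eqP dv]]; apply/andP; split.
- exact: rpred0.
- by rewrite linear0.
- by rewrite rpredD ?rpredZ.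
- by rewrite linearP/= du dv scaler0 addr0.
Qed.
HB.instance Definition _ n := GRing.isSubmodClosed.Build K _ (cocycle n)
  (GRing.submod_closed_semi (cocycle_closed n)).

Definition cocycles n : Type := {x : M n | x \in cocycle n}.
HB.instance Definition _ n := [isSub of cocycles n for @sval _ _].
HB.instance Definition _ n := [Choice of cocycles n by <:].
HB.instance Definition _ n :=
  [SubChoice_isSubLmodule of cocycles n by <:].

Definition coboundary n : {pred cocycles n} :=
  match n return {pred cocycles n} with
  | 0 => fun z => z == 0
  | m.+1 => fun z => `[< exists2 y, y \in C m & val z = d m y >]
  end.
Arguments coboundary : clear implicits.

Fact coboundary_closed n : submod_closed (coboundary n).
Proof.
case: n => [|n].
  split=> [|a u v /eqP -> /eqP ->]; apply/eqP => //.
  by rewrite scaler0 addr0.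
split=> [|a u v /asboolP[u' Cu' u'E] /asboolP[v' Cv' v'E]]; apply/asboolP.
  by exists 0; rewrite ?rpred0 ?linear0.
by exists (a *: u' + v'); rewrite ?rpredD ?rpredZ// !linearP/= u'E v'E.
Qed.
HB.instance Definition _ n := GRing.isSubmodClosed.Build K _ (coboundary n)
  (GRing.submod_closed_semi (coboundary_closed n)).

Definition cohomology n : Type := lquot (coboundary n).
HB.instance Definition _ n := GRing.Lmodule.on (cohomology n).

Definition coclass n (z : cocycles n) : cohomology n := qclass (coboundary n) z.

End Cohomology.

(* f is the map [z] |-> [phi z] (which requires phi z to be a cocycle). *)
Definition induced_by (K : fieldType) (M N : nat -> lmodType K)
    (dM : forall n, {linear M n -> M n.+1})
    (dN : forall n, {linear N n -> N n.+1})
    (CM : forall n, submodClosed (M n)) (CN : forall n, submodClosed (N n))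
    n (phi : M n -> N n) (f : cohomology dM CM n -> cohomology dN CN n) : Prop :=
  forall z : cocycles dM CM n, exists2 w : cocycles dN CN n,
    val w = phi (val z) & f (coclass z) = coclass w.

(* Associative algebras, not assumed to have a unit. *)
HB.mixin Record Lmodule_isNUAlgebra (K : fieldType) A of GRing.Lmodule K A := {
  numul : {bilinear A -> A -> A};
  numulA : associative numul
}.

#[short(type="nuAlgType")]
HB.structure Definition NUAlgebra (K : fieldType) :=
  {A of GRing.Lmodule K A & Lmodule_isNUAlgebra K A}.

Notation "x ** y" := (numul x y) (at level 40, left associativity) : ring_scope.

Section CyclicCohomologyAlgebra.
Variables (K : fieldType) (A : nuAlgType K).

(* The ambient space of all functions; (n+1)-linearity is imposed in
   cyclic_cochain. *)
Definition cochain n : Type := n.+1.-tuple A -> K^o.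
HB.instance Definition _ n := GRing.Lmodule.on (cochain n).

Definition hoch_b n (phi : cochain n) : cochain n.+1 := fun x =>
  \sum_(i < n.+1) (-1) ^+ i *
    phi (tup n.+1 (take i x ++ (x`_i ** x`_i.+1) :: drop i.+2 x))
  + (-1) ^+ n.+1 * phi (tup n.+1 ((x`_n.+1 ** x`_0) :: take n (behead x))).

Fact hoch_b_is_linear n : linear (@hoch_b n).
Proof.
move=> a f g; apply/funext => x.
have E c t : c * (a *: f + g) t = a * (c * f t) + c * g t.
  by rewrite mulrCA -mulrDr.
transitivity (a * hoch_b f x + hoch_b g x) => //.
rewrite /hoch_b E mulrDr mulr_sumr addrACA -big_split/=; congr (_ + _).
by apply: eq_bigr => i _; rewrite E.
Qed.
HB.instance Definition _ n :=
  GRing.isLinear.Build K (cochain n) (cochain n.+1) *:%R (@hoch_b n)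
    (@hoch_b_is_linear n).

Definition cyclic_cochain n : {pred cochain n} := fun phi =>
  `[< multilinear phi /\
      forall x : n.+1.-tuple A, phi [tuple of rotr 1 x] = (-1) ^+ n * phi x >].
Arguments cyclic_cochain : clear implicits.

Fact cyclic_cochain_closed n : submod_closed (cyclic_cochain n).
Proof.
split=> [|a f g /asboolP[f_ml f_cyc] /asboolP[g_ml g_cyc]]; apply/asboolP.
  split=> [t i b u v|x]; last by rewrite [RHS]mulr0.
  by rewrite /= [RHS]addr0 [RHS]scaler0.
have E t : (a *: f + g) t = a * f t + g t by [].
split=> [t i b u v|x]; rewrite !E.
  rewrite f_ml g_ml scalerDr mulrDr addrACA; congr (_ + _ + _).
  by rewrite [LHS]mulrCA.
by rewrite f_cyc g_cyc mulrDr mulrCA.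
Qed.
HB.instance Definition _ n := GRing.isSubmodClosed.Build K _ (cyclic_cochain n)
  (GRing.submod_closed_semi (cyclic_cochain_closed n)).

End CyclicCohomologyAlgebra.

Arguments cyclic_cochain {K} A n phi.

Section Action.
Variables (K : fieldType) (H : hopfAlgType K) (A : nuAlgType K).

Record is_action (act : {bilinear H -> A -> A}) : Prop := {
  actM : forall g h a, act (g * h) a = act g (act h a);
  act_numul : forall h a b,
    act h (a ** b) = tlift2 (fun h1 h2 => act h1 a ** act h2 b) (comul h)
}.

Variables (act : {bilinear H -> A -> A}) (tau : {scalar A}).

Definition sigma_trace (sigma : H) : Prop :=
  forall a b, tau (a ** b) = tau (b ** act sigma a).

Definition delta_invariant (delta : {lrmorphism H -> K^o}) : Prop :=
  forall h a b,
    tau (act h a ** b) = tau (a ** act (twisted_antipode delta h) b).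

(* tau (x^0 h^1(x^1) ... h^n(x^n)). *)
Definition gamma_form n (h : n.-tuple H) : cochain A n := fun x =>
  tau (foldl (fun p hx => p ** act hx.1 hx.2) (thead x) (zip h (behead x))).

Definition gamma n : {linear tpow H n -> cochain A n} := tlift (@gamma_form n).

End Action.

Definition HC_hopf (K : fieldType) (H : hopfAlgType K)
    (delta : {lrmorphism H -> K^o}) (sigma : H) (n : nat) : lmodType K :=
  cohomology (M := tpow H) (hopf_b sigma) (cyclic_elt delta sigma) n.

Definition HC_alg (K : fieldType) (A : nuAlgType K) (n : nat) : lmodType K :=
  cohomology (M := cochain A) (@hoch_b K A) (cyclic_cochain A) n.

(* Main.v *)
(* Evaluated on x^0, ..., x^n, the image under gamma of each face and of the
   cyclic operator is the corresponding operation on the arguments, so gamma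
   carries cyclic elements to cyclic cochains and commutes with b.
   - Inner faces: h(ab) = \sum h_(1)(a) h_(2)(b).
   - Last face: tau(P sigma(a)) = tau(a P).
   - Cyclic operator: by the multiplicativity of the action, the diagonal factor
     of tau_n acts on the whole product of the last n arguments;
     delta-invariance moves h^1 back to x^0, and the sigma-trace property moves
     sigma(x^n) to the front.
   - Face 0: 1 need not act as the identity, but
     tau(1(a) b) = tau(a 1(b)) = tau(1(b) sigma(a)) = tau(b (1 sigma)(a))
     = tau(b sigma(a)) = tau(a b), so tau does not see it inside a product. *)
From HB Require Import structures.
Require Import Defs.
From mathcomp Require Import all_boot all_order all_algebra sesquilinear.
From mathcomp Require Import boolp reals complex.
From mathcomp Require Import functions freeg zify.

Set Implicit Arguments.
Unset Strict Implicit.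
Unset Printing Implicit Defensive.

Import GRing.Theory.

Local Open Scope ring_scope.

(** * Induction on tensors and linearity of lifts *)

Section TensorPower.
Variables (K : fieldType) (V : lmodType K).

Lemma val_tup n (s : seq V) : size s = n -> tup n s = s :> seq V.
Proof.
move=> sz; apply: (@eq_from_nth _ 0); rewrite size_tuple// => k kn.
by rewrite -[k]/(val (Ordinal kn)) -tnth_nth tnth_mktuple.
Qed.

Lemma nth_upd n (t : n.-tuple V) i v k :
  (upd t i v)`_k = if k == i then v else t`_k.
Proof.
have [kn|nk] := ltnP k n.
  by rewrite -[k]/(val (Ordinal kn)) -!tnth_nth tnth_mktuple.
rewrite !nth_default ?size_tuple//; case: eqP => // ki.
by rewrite ki leqNgt ltn_ord in nk.
Qed.

Lemma val_upd n (t : n.-tuple V) (i : 'I_n) v :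
  upd t i v = take i t ++ v :: drop i.+1 t :> seq V.
Proof.
have szi : size (take i t) = i.
  by rewrite size_takel ?size_tuple ?(ltnW (ltn_ord i)).
apply: (@eq_from_nth _ 0) => [|k _].
  by rewrite size_cat/= szi size_drop !size_tuple ?card_ord addnS -addSn subnKC.
rewrite nth_upd nth_cat szi; case: ltngtP => [ki|ik|->].
- by rewrite nth_take.
- by rewrite -(subnSK ik)/= nth_drop subnKC.
- by rewrite subnn.
Qed.

Lemma updE n (t u : n.-tuple V) (i : 'I_n) v :
  (forall k, u`_k = if k == i then v else t`_k) -> u = upd t i v.
Proof.
move=> tu; apply/val_inj/(@eq_from_nth _ 0) => [|k _].
  by rewrite !size_tuple.
by rewrite tu nth_upd.
Qed.

(** A representative in the free module is a finite combination of tuples, whose classes are pure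
    tensors. Serves for statements that are not equalities of packed linear maps, such as
    multilinearity of the values of [gamma]. *)
Lemma tpow_ind n (P : tpow V n -> Prop) :
  (forall t, P (pure t)) -> (forall a x y, P x -> P y -> P (a *: x + y)) ->
  forall x, P x.
Proof.
move=> P_pure P_lin x.
have P0 : P 0.
  (* 0 arises as -t + t; it starts the induction on the sum. *)
  have := P_lin (-1) _ _ (P_pure (tup n [::])) (P_pure (tup n [::])).
  by rewrite scaleN1r addNr.
rewrite -(qreprK x) -(freeg_sumE (qrepr x)) linear_sum.
elim: (X in \sum_(_ <- X) _) => [|t s IHs]; first by rewrite big_nil.
have E k : << k *g t >> = k *: << t >> :> {freeg (n.-tuple V) / K}.
  by apply/eqP/freeg_eqP => u; rewrite coeffZ !coeffU mul1r.
by rewrite big_cons E linearZ; exact: P_lin (P_pure _) IHs.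
Qed.

(** Since [tlift] is 0 by convention off multilinear maps, linearity in the map is stated for
    multilinear [f] and [g]. It shows that a lift nested inside another is multilinear in the outer
    tuple. *)
Lemma tlift_lincomb (W : lmodType K) n (a : K) (f g e : n.-tuple V -> W) :
  multilinear f -> multilinear g -> (forall t, e t = a *: f t + g t) ->
  forall x, tlift e x = a *: tlift f x + tlift g x.
Proof.
move=> f_ml g_ml efg.
have e_ml : multilinear e.
  move=> t i b u v; rewrite !efg f_ml g_ml !scalerDr !scalerA addrACA.
  by rewrite (mulrC a b).
elim/tpow_ind => [t|b x y IHx IHy]; first by rewrite !tlift_pure.
by rewrite !linearP/= IHx IHy !scalerDr !scalerA addrACA.
Qed.

Lemma tlift2_pure (W : lmodType K) (F : V -> V -> W) a b :
  (forall u, linear (F u)) -> (forall v, linear (F^~ v)) ->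
  tlift2 F (pure [tuple a; b]) = F a b.
Proof.
move=> Fr Fl; rewrite /tlift2 tlift_pure// => t i c u v.
rewrite !nth_upd; case: i => [[|[|//]]]/= _; [exact: Fl|exact: Fr].
Qed.

End TensorPower.


(** [pure] is multilinear, so it is enough that changing one entry of [t] changes a single entry of
    [F t], linearly; that entry may sit at another rank [j]. *)
Lemma multilinear_pure (K : fieldType) (U V : lmodType K) n m
    (F : n.-tuple U -> m.-tuple V) :
  (forall t i, exists j (l : U -> V),
     linear l /\ forall v, F (upd t i v) = upd (F t) j (l v)) ->
  multilinear (fun t => pure (F t)).
Proof.
move=> FP t i a u v; have [j [l [l_lin Fl]]] := FP t i.
by rewrite !Fl l_lin pure_multilinear.
Qed.

(** * Replacing one tensor factor by two *)

Section Splice.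
Variables (K : fieldType) (V : lmodType K) (n i : nat).

Definition splice (h : n.-tuple V) (t : 2.-tuple V) : n.+1.-tuple V :=
  tup n.+1 (take i h ++ t ++ drop i.+1 h).

Hypothesis i_n : (i < n)%N.

Lemma val_splice h t : splice h t = take i h ++ t ++ drop i.+1 h :> seq V.
Proof.
rewrite val_tup// !size_cat size_takel ?size_drop ?size_tuple ?(ltnW i_n)//.
by lia.
Qed.

Lemma nth_splice h t k : (splice h t)`_k =
  if (k < i)%N then h`_k else if (k < i.+2)%N then t`_(k - i) else h`_k.-1.
Proof.
have szi : size (take i h) = i by rewrite size_takel ?size_tuple ?(ltnW i_n).
rewrite val_splice nth_cat szi; case: ltnP => ki; first by rewrite nth_take.
rewrite nth_cat size_tuple ltn_subLR// addn2; case: ltnP => // ik.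
by rewrite nth_drop; congr nth; lia.
Qed.

Lemma splice_multilinear h : multilinear (fun t => pure (splice h t)).
Proof.
apply: multilinear_pure => t j.
have ji : (i + j < n.+1)%N by have := ltn_ord j; lia.
exists (Ordinal ji), id; split=> // v; apply: updE => k.
rewrite !nth_splice nth_upd -[nat_of_ord (Ordinal _)]/(i + j)%N.
have j2 := ltn_ord j.
case: (eqVneq k (i + j)%N) => [->|kij].
  by rewrite ltnNge leq_addr/= (_ : (i + j < i.+2)%N) ?addKn ?eqxx//; lia.
case: ltnP => // ik; case: ltnP => // _.
by rewrite (_ : (k - i == j)%N = false)//; apply/eqP; lia.
Qed.

(** The entry of rank [i] is dropped; any other survives exactly once, at [j']: same rank if before
    [i], one higher if after. *)
Lemma splice_upd_linear t h (j : 'I_n) :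
  j != i :> nat -> linear (fun v => pure (splice (upd h j v) t)).
Proof.
move=> ji; pose j' := if (j < i)%N then nat_of_ord j else j.+1.
have j'n : (j' < n.+1)%N by rewrite /j'; have := ltn_ord j; case: ifP; lia.
have E v : splice (upd h j v) t = upd (splice h t) (Ordinal j'n) v.
  apply: updE => k; rewrite !nth_splice !nth_upd.
  rewrite -[nat_of_ord (Ordinal _)]/j' /j'.
  move: ji; case: (ltngtP j i) => // ji _.
  - case: ltnP => ki; first by case: eqP.
    rewrite (_ : (k == j)%N = false); last by apply/eqP; lia.
    case: ltnP => // ki2.
    by rewrite (_ : (k.-1 == j)%N = false)//; apply/eqP; lia.
  - case: ltnP => ki.
      rewrite (_ : (k == j)%N = false); last by apply/eqP; lia.
      by rewrite (_ : (k == j.+1)%N = false)//; apply/eqP; lia.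
    case: ltnP => ki2.
      by rewrite (_ : (k == j.+1)%N = false)//; apply/eqP; lia.
    by rewrite (_ : (k.-1 == j)%N = (k == j.+1))//; apply/eqP/eqP; lia.
by move=> a u v; rewrite !E pure_multilinear.
Qed.

End Splice.

(** * Products and insertions on pure tensors *)

Section TensorOps.
Variables (K : fieldType) (H : algType K).

Lemma nth_mul_tuple n (a b : n.-tuple H) k :
  [tuple tnth a i * tnth b i | i < n]`_k = a`_k * b`_k.
Proof.
have [kn|nk] := ltnP k n; last by rewrite !nth_default ?size_tuple ?mul0r.
by rewrite -[k]/(val (Ordinal kn)) -!tnth_nth tnth_mktuple.
Qed.

Lemma mul_tuple_multilinearr n (a : n.-tuple H) :
  multilinear (fun b => pure [tuple tnth a i * tnth b i | i < n]).
Proof.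
apply: multilinear_pure => b j; exists j, ( *%R a`_j); split=> [c u v|v].
  by rewrite mulrDr scalerAr.
by apply: updE => k; rewrite !nth_mul_tuple nth_upd; case: eqP => // ->.
Qed.

Lemma mul_tuple_multilinearl n (b : n.-tuple H) :
  multilinear (fun a => pure [tuple tnth a i * tnth b i | i < n]).
Proof.
apply: multilinear_pure => a j; exists j, ( *%R^~ b`_j); split=> [c u v|v].
  by rewrite mulrDl scalerAl.
by apply: updE => k; rewrite !nth_mul_tuple nth_upd; case: eqP => // ->.
Qed.

Lemma tmul_purel n (s : n.-tuple H) (y : tpow H n) :
  tmul (pure s) y =
  tlift (fun t => pure [tuple tnth s i * tnth t i | i < n]) y.
Proof.
rewrite /tmul tlift_pure// => a i c u v.
apply: tlift_lincomb => [||t]; first exact: mul_tuple_multilinearr.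
  exact: mul_tuple_multilinearr.
exact: mul_tuple_multilinearl.
Qed.

Lemma tmul_pure n (s t : n.-tuple H) :
  tmul (pure s) (pure t) = pure [tuple tnth s i * tnth t i | i < n].
Proof.
by rewrite tmul_purel tlift_pure//; exact: mul_tuple_multilinearr.
Qed.

Lemma tmul_linearl n (y : tpow H n) : linear (fun x => tmul x y).
Proof. by move=> a u v; rewrite /tmul linearP. Qed.

(** [y] sits inside the inner lift, so linearity in it is first reduced to pure [x], where a single
    lift remains. *)
Lemma tmul_linearr n (x : tpow H n) : linear (tmul x).
Proof.
move=> a y z; elim/tpow_ind: x => [s|b u v IHu IHv].
  by rewrite !tmul_purel linearP.
rewrite !tmul_linearl IHu IHv !scalerDr !scalerA addrACA.
by rewrite (mulrC a b).
Qed.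

Lemma insert_at_pure (D : {linear H -> tpow H 2}) n i (h : n.-tuple H) :
  (i < n)%N ->
  insert_at D i (pure h) =
  tlift (fun t : 2.-tuple H => pure (splice i h t)) (D h`_i).
Proof.
move=> i_n; rewrite /insert_at tlift_pure//.
move=> g j a u v; rewrite !nth_upd; case: eqVneq => [ij|ij].
  (* Case [i = j]: [splice] ignores this entry, which enters only through the linear map [D]. *)
  have E w t : splice i (upd g j w) t = splice i g t.
    apply/val_inj/(@eq_from_nth _ 0) => [|k _]; first by rewrite !size_tuple.
      rewrite !nth_splice// !nth_upd -ij.
    case: (ltngtP k i) => ki; case: (ltnP k i.+2) => // ki2; try lia.
    by rewrite (_ : (k.-1 == i)%N = false)//; apply/eqP; lia.
  have tE w : tlift (fun t => pure (splice i (upd g j w) t)) =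
              tlift (fun t => pure (splice i g t)).
    by congr tlift; apply/funext => t; rewrite E.
  rewrite [tlift _]tE [in X in _ = _ *: X + _]tE [in X in _ = _ + X]tE.
  by rewrite !linearP.
(* Case [i != j]: the argument of the lift is fixed and the lifted map is linear in entry [j]. *)
apply: tlift_lincomb.
- exact: (splice_multilinear i_n (upd g j u)).
- exact: (splice_multilinear i_n (upd g j v)).
- by move=> t; apply: (splice_upd_linear i_n); rewrite eq_sym.
Qed.

End TensorOps.

(** * Faces and cyclic operator on pure tensors *)

Section HopfOps.
Variables (K : fieldType) (H : hopfAlgType K).
Variables (delta : {lrmorphism H -> K^o}) (sigma : H).

Lemma twisted_antipode_linear : linear (twisted_antipode delta).
Proof. by move=> a g h; rewrite /twisted_antipode linearP/= linearP. Qed.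

Lemma comul_iter_linear n : linear (comul_iter (H := H) n).
Proof.
elim: n => [|n IHn] a g h /=; last by rewrite IHn linearP.
have E v : [tuple v] = upd [tuple g] ord0 v :> 1.-tuple H.
  by apply: updE => -[|k]; rewrite //= nth_nil.
by rewrite [in LHS]E pure_multilinear -!E.
Qed.

(** The coproduct of 1 has one term, so the antipode axiom at 1 reads S(1) 1 = ε(1) 1. *)
Lemma antipode1 : antipode (1 : H) = 1.
Proof.
have := antipodel (1 : H); rewrite comul1 tlift2_pure.
- by rewrite mulr1 rmorph1 scale1r.
- by move=> g a u v; rewrite mulrDr scalerAr.
- by move=> g a u v; rewrite linearP mulrDl scalerAl.
Qed.

Lemma twisted_antipode1 : twisted_antipode delta 1 = 1.
Proof.
rewrite /twisted_antipode comul1.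
rewrite (tlift2_pure (F := fun a b => (delta a : K) *: antipode b)).
- by rewrite rmorph1 scale1r antipode1.
- by move=> g a u v; rewrite linearP scalerDr !scalerA mulrC.
- by move=> g a u v /=; rewrite linearP scalerDl scalerA.
Qed.

Lemma face0_pure n (h : n.-tuple H) :
  face sigma n 0 (pure h) = pure [tuple of 1 :: h].
Proof.
rewrite /face/= tlift_pure//; apply: multilinear_pure => t i.
exists (fintype.lift ord0 i), id; split=> // v; apply: updE => -[|k] //=.
by rewrite nth_upd.
Qed.

Lemma face_last_pure n (h : n.-tuple H) :
  face sigma n n.+1 (pure h) = pure [tuple of rcons h sigma].
Proof.
rewrite /face/= ltnn tlift_pure//; apply: multilinear_pure => t i.
exists (widen_ord (leqnSn n) i), id; split=> // v; apply: updE => k /=.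
rewrite !nth_rcons !size_tuple ?card_ord nth_upd; case: ltngtP => // nk.
- by rewrite gtn_eqF// (ltn_trans _ nk).
- by rewrite nk gtn_eqF.
Qed.

Lemma cyclic_op_pure n (h : n.+1.-tuple H) :
  cyclic_op delta sigma (pure h) =
  tmul (comul_iter n (twisted_antipode delta (thead h)))
    (pure [tuple of rcons (behead h) sigma]).
Proof.
rewrite /= tlift_pure// => t i a u v.
have thead_upd w : thead (upd t i w) = if i == ord0 then w else thead t.
  by rewrite /thead tnth_mktuple eq_sym.
(* An entry of positive rank occurs only in the right factor, one rank lower; the first entry occurs
   only in the left factor, through linear maps. *)
rewrite !thead_upd; case: (unliftP ord0 i) => [j ->|->].
  rewrite -tmul_linearr; congr tmul.
  have E w : [tuple of rcons (behead (upd t (fintype.lift ord0 j) w)) sigma] =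
      upd [tuple of rcons (behead t) sigma] (widen_ord (leqnSn n) j) w.
    apply: updE => k.
    rewrite !nth_rcons !size_tuple ?card_ord !nth_behead nth_upd/=.
    rewrite eqSS; case: ltngtP => // nk.
    - by rewrite gtn_eqF// (ltn_trans _ nk).
    - by rewrite nk gtn_eqF.
  by rewrite !E pure_multilinear.
rewrite twisted_antipode_linear comul_iter_linear tmul_linearl.
have E w : [tuple of rcons (behead (upd t ord0 w)) sigma] =
    [tuple of rcons (behead t) sigma].
  apply/val_inj; congr rcons; apply: (@eq_from_nth _ 0) => [|k _].
    by rewrite !size_tuple.
  by rewrite !nth_behead nth_upd.
by rewrite !E.
Qed.

End HopfOps.

(** * [gamma] on pure tensors, and multilinearity *)

Section Gamma.
Variables (K : fieldType) (H : hopfAlgType K) (A : nuAlgType K).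
Variables (act : {bilinear H -> A -> A}) (tau : {scalar A}).

(** The product starts from an accumulator [p], in the role of x^0, because [A] is not assumed to
    have a unit. *)
Definition act_prod (p : A) (h : seq H) (x : seq A) : A :=
  foldl (fun p hx => p ** act hx.1 hx.2) p (zip h x).

Lemma act_prod_cat p h1 h2 x1 x2 :
  size h1 = size x1 ->
  act_prod p (h1 ++ h2) (x1 ++ x2) = act_prod (act_prod p h1 x1) h2 x2.
Proof. by move=> hx; rewrite /act_prod zip_cat// foldl_cat. Qed.

Lemma act_prod_linear h x : linear (fun p => act_prod p h x).
Proof.
move=> a p q; rewrite /act_prod; elim: (zip h x) p q => //= hx s IHs p q.
by rewrite linearPl IHs.
Qed.

Lemma numul_act_prod p q h x : p ** act_prod q h x = act_prod (p ** q) h x.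
Proof.
rewrite /act_prod; elim: (zip h x) q => //= hx s IHs q.
by rewrite IHs numulA.
Qed.

Lemma act_prod_foldl p h x :
  act_prod p h x = foldl numul p [seq act hx.1 hx.2 | hx <- zip h x].
Proof. by rewrite /act_prod; elim: (zip h x) p => /=. Qed.

Lemma cochainE n a (f g : cochain A n) x : (a *: f + g) x = a * f x + g x.
Proof. by []. Qed.

Lemma gamma_form_multilinear n : multilinear (gamma_form act tau (n := n)).
Proof.
move=> h i a u v; apply/funext => x; rewrite cochainE /gamma_form.
rewrite -!/(act_prod _ _ _) !val_upd.
have E w : act_prod (thead x) (take i h ++ w :: drop i.+1 h) (behead x) =
    act_prod (act_prod (thead x) (take i h) (take i (behead x)) **
      act w (behead x)`_i) (drop i.+1 h) (drop i.+1 (behead x)).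
  rewrite -[in LHS](cat_take_drop i (behead x)).
  rewrite [drop i (behead _)](drop_nth 0) ?size_tuple ?ltn_ord//.
  by rewrite act_prod_cat// !size_takel ?size_tuple// ltnW// ltn_ord.
by rewrite !E linearPl linearPr act_prod_linear linearP.
Qed.

Lemma gamma_pure n (h : n.-tuple H) x :
  gamma act tau n (pure h) x = tau (act_prod x`_0 h (behead x)).
Proof.
rewrite -[gamma _ _ _ _]/(tlift (gamma_form act tau (n := n)) (pure h)).
rewrite tlift_pure; last exact: gamma_form_multilinear.
by rewrite /gamma_form /thead (tnth_nth 0).
Qed.

Lemma gammaP n a (c d : tpow H n) x :
  gamma act tau n (a *: c + d) x =
  a * gamma act tau n c x + gamma act tau n d x.
Proof. by rewrite linearP cochainE. Qed.

Lemma gamma_multilinear n (c : tpow H n) : multilinear (gamma act tau n c).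
Proof.
elim/tpow_ind: c => [h|a c d c_ml d_ml] x i b u v; last first.
  rewrite !gammaP c_ml d_ml mulrDr addrACA; congr (_ + _).
  by rewrite scalerDr; congr (_ + _); exact: mulrCA.
rewrite !gamma_pure !nth_upd !val_upd.
(* No tensor factor acts on x^0, so it is treated apart. *)
case: i => -[|i] i_n/=.
  by rewrite take0/= act_prod_linear linearP.
move: i_n; rewrite ltnS => i_n.
case/tupleP: x => x0 x /=.
have E w : act_prod x0 h (take i x ++ w :: drop i.+1 x) =
    act_prod (act_prod x0 (take i h) (take i x) ** act h`_i w)
      (drop i.+1 h) (drop i.+1 x).
  rewrite -[in LHS](cat_take_drop i h) [drop i h](drop_nth 0) ?size_tuple//.
  by rewrite act_prod_cat// !size_takel ?size_tuple// ltnW.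
by rewrite !E !linearPr act_prod_linear linearP.
Qed.

(** * Compatibility with the faces *)

Hypothesis act_action : is_action act.

(** Entry [i] of a pure tensor acts on argument [i.+1], as ranks count from 0 and x^0 is free. Its
    two coproduct factors act on neighbouring arguments, hence jointly on their product. *)
Lemma gamma_insert n i (c : tpow H n) (x : n.+2.-tuple A) :
  (i < n)%N ->
  gamma act tau n.+1 (insert_at comul i c) x =
  gamma act tau n c
    (tup n.+1 (take i.+1 x ++ (x`_i.+1 ** x`_i.+2) :: drop i.+3 x)).
Proof.
move=> i_n; elim/tpow_ind: c => [h|a c d IHc IHd]; last first.
  by rewrite linearP !gammaP IHc IHd.
case/tupleP: x => x0 x.
have szx : size (take i h) = size (take i x).
  by rewrite !size_takel ?size_tuple// ltnW// ltnW.
(* A coproduct need not be pure, so the identity is proved for every [y] in the tensor square by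
   linearity. *)
have splice_prod (y : tpow H 2) :
    gamma act tau n.+1 (tlift (fun t => pure (splice i h t)) y)
      [tuple of x0 :: x] =
    tau (act_prod (act_prod x0 (take i h) (take i x) **
      tlift2 (fun g1 g2 => act g1 x`_i ** act g2 x`_i.+1) y)
      (drop i.+1 h) (drop i.+2 x)).
  elim/tpow_ind: y => [t|a c d IHc IHd]; last first.
    rewrite (linearP (tlift _)) gammaP IHc IHd (linearP (tlift2 _)).
    by rewrite linearPr act_prod_linear linearP.
  rewrite tlift_pure; last exact: splice_multilinear.
  rewrite gamma_pure val_splice//.
  case/tupleP: t => a t; case/tupleP: t => b t; rewrite (tuple0 t).
  rewrite (_ : [tuple of a :: _] = [tuple a; b]); last exact: val_inj.
  rewrite (tlift2_pure (F := fun g1 g2 => act g1 x`_i ** act g2 x`_i.+1)).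
  - rewrite numulA [_`_0]/= [behead _]/= -[in LHS](cat_take_drop i x).
    rewrite [drop i x](drop_nth 0) ?size_tuple ?ltnS ?(ltnW i_n)//.
    by rewrite [drop i.+1 x](drop_nth 0) ?size_tuple// act_prod_cat.
  - by move=> g c u v /=; rewrite linearPl linearPr.
  - by move=> g c u v /=; rewrite linearPl linearPl.
rewrite insert_at_pure// splice_prod -(act_numul act_action) gamma_pure.
rewrite val_tup; last first.
  by rewrite size_cat size_takel/= ?size_drop ?size_tuple; lia.
rewrite -[in RHS](cat_take_drop i h) [drop i h](drop_nth 0) ?size_tuple//=.
by rewrite act_prod_cat.
Qed.

Variables (delta : {lrmorphism H -> K^o}) (sigma : H).
Hypotheses (tau_trace : sigma_trace act tau sigma)
  (tau_inv : delta_invariant act tau delta).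

Lemma act_comul_pure (g : H) (a b : A) :
  comul g = pure [tuple g; g] -> act g (a ** b) = act g a ** act g b.
Proof.
move=> g_comul; rewrite (act_numul act_action) g_comul.
rewrite (tlift2_pure (F := fun g1 g2 => act g1 a ** act g2 b))//.
- by move=> c k u v /=; rewrite linearPl linearPr.
- by move=> c k u v /=; rewrite linearPl linearPl.
Qed.

(** The trace brings 1(q) to the front, where invariance moves 1 onto sigma(p), and 1 sigma = sigma
    absorbs it. *)
Lemma tau_act1r (p q : A) : tau (p ** act 1 q) = tau (p ** q).
Proof.
rewrite tau_trace tau_inv (twisted_antipode1 delta).
by rewrite -(actM act_action) mul1r -tau_trace.
Qed.

Lemma tau_act1l (p q : A) : tau (act 1 p ** q) = tau (p ** q).
Proof. by rewrite tau_inv (twisted_antipode1 delta) tau_act1r. Qed.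

(** When factors remain to the right of [q], [tau_act1r] does not apply directly. Instead 1 is made
    to act on the whole left part: 1(p 1(q)) = 1(p) 1(1(q)) = 1(p) 1(q) = 1(pq). *)
Lemma tau_act_prod1 (p q : A) h x :
  tau (act_prod (p ** act 1 q) h x) = tau (act_prod (p ** q) h x).
Proof.
case: x => [|y x]; first by case: h => [|? ?]; exact: tau_act1r.
case: h => [|g h]; first exact: tau_act1r.
have act_prod_cons r : act_prod r (g :: h) (y :: x) =
    r ** act_prod (act g y) h x by rewrite numul_act_prod.
rewrite !act_prod_cons -tau_act1l -[RHS]tau_act1l.
by rewrite !act_comul_pure ?comul1// -(actM act_action) mulr1.
Qed.

(** Face [i.+1] inserts the coproduct at rank [i]. Face 0 lets 1 act on x^1, and [tau_act_prod1]
    removes it. *)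
Lemma gamma_face n i (c : tpow H n) (x : n.+2.-tuple A) :
  (i <= n)%N ->
  gamma act tau n.+1 (face sigma n i c) x =
  gamma act tau n c
    (tup n.+1 (take i x ++ (x`_i ** x`_i.+1) :: drop i.+2 x)).
Proof.
case: i => [_|i i_n]; last by rewrite /face/= i_n gamma_insert.
elim/tpow_ind: c => [h|a c d IHc IHd]; last first.
  by rewrite linearP !gammaP IHc IHd.
rewrite face0_pure !gamma_pure; case/tupleP: x => x0 x; case/tupleP: x => x1 x.
rewrite val_tup ?size_tuple//=; last by rewrite drop0 size_tuple.
by rewrite drop0 -tau_act_prod1.
Qed.

Lemma gamma_face_last n (c : tpow H n) (x : n.+2.-tuple A) :
  gamma act tau n.+1 (face sigma n n.+1 c) x =
  gamma act tau n c (tup n.+1 ((x`_n.+1 ** x`_0) :: take n (behead x))).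
Proof.
elim/tpow_ind: c => [h|a c d IHc IHd]; last first.
  by rewrite linearP !gammaP IHc IHd.
rewrite face_last_pure !gamma_pure; case/tupleP: x => x0 x.
rewrite val_tup/=; last by rewrite size_takel// size_tuple.
rewrite -[in LHS](cat_take_drop n x) [drop n x](drop_nth 0) ?size_tuple//.
rewrite [drop n.+1 _]drop_oversize ?size_tuple// -cats1.
rewrite act_prod_cat; last first.
  by rewrite size_takel ?size_tuple.
(* On the right x^{n+1} is the leftmost factor; the trace moves it to the end, with sigma
   applied. *)
by rewrite -numul_act_prod [RHS]tau_trace.
Qed.

(** * Compatibility with the cyclic operator *)

Lemma act_prodM p h g x :
  act_prod p [seq hg.1 * hg.2 | hg <- zip h g] x =
  act_prod p h [seq act gx.1 gx.2 | gx <- zip g x].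
Proof.
elim: h p g x => [|h0 h IHh] p [|g0 g] [|x0 x] //=.
by rewrite /act_prod/= (actM act_action) -!/(act_prod _ _ _) IHh.
Qed.

Lemma gamma_tmul n (c : tpow H n) (g : n.-tuple H) (x : n.+1.-tuple A) :
  gamma act tau n (tmul c (pure g)) x =
  gamma act tau n c
    (tup n.+1 (x`_0 :: [seq act gx.1 gx.2 | gx <- zip g (behead x)])).
Proof.
elim/tpow_ind: c => [h|a c d IHc IHd]; last first.
  by rewrite tmul_linearl !gammaP IHc IHd.
rewrite tmul_pure !gamma_pure val_tup/=; last first.
  by rewrite size_map size1_zip ?size_tuple.
rewrite -act_prodM; congr (tau (act_prod _ _ _)).
apply: (@eq_from_nth _ 0) => [|k].
  by rewrite size_tuple card_ord size_map size1_zip !size_tuple.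
rewrite size_tuple card_ord => kn; rewrite nth_mul_tuple.
by rewrite (nth_map (0, 0)) ?nth_zip ?size1_zip ?size_tuple.
Qed.

(** Each insertion at rank 0 merges x^1 and x^2, so by induction the iterated coproduct acts as [h]
    on the product of all arguments after x^0. *)
Lemma gamma_comul_iter n (h : H) (x : n.+2.-tuple A) :
  gamma act tau n.+1 (comul_iter n h) x =
  tau (x`_0 ** act h (foldl numul x`_1 (drop 2 x))).
Proof.
elim: n x => [|n IHn] x.
  rewrite gamma_pure; case/tupleP: x => x0 x; case/tupleP: x => x1 x.
  by rewrite (tuple0 x).
rewrite [comul_iter _ _]/= gamma_insert// IHn.
case/tupleP: x => x0 x; case/tupleP: x => x1 x; case/tupleP: x => x2 x.
by rewrite val_tup/= ?drop0 ?size_tuple.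
Qed.

Lemma gamma_cyclic_op n (c : tpow H n) (x : n.+1.-tuple A) :
  gamma act tau n (cyclic_op delta sigma c) x =
  gamma act tau n c [tuple of rotr 1 x].
Proof.
case: n c x => [|n] c x.
  (* In degree 0 both the operator and the rotation are the identity. *)
  congr (gamma _ _ _ _ _); apply/val_inj => /=.
  by case/tupleP: x => x0 x; rewrite (tuple0 x).
elim/tpow_ind: c => [h|a c d IHc IHd]; last first.
  by rewrite linearP !gammaP IHc IHd.
rewrite cyclic_op_pure gamma_tmul gamma_comul_iter gamma_pure.
case/tupleP: h => h0 h; case/tupleP: x => x0 x; case/tupleP: x => x1 x.
(* The arguments after x^0 are [y] followed by [z]: the entries of [h] act on [y], and sigma acts on
   [z], which the rotation brings to the front. *)
set y := belast x1 x; set z := last x1 x.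
have szy : size y = n by rewrite size_belast size_tuple.
rewrite theadE; set l := [seq _ | _ <- _].
have lE : l = rcons [seq act gx.1 gx.2 | gx <- zip h y] (act sigma z).
  transitivity
      [seq act gx.1 gx.2 | gx <- zip (rcons h sigma) (rcons y z)].
    by rewrite -lastI.
  by rewrite zip_rcons ?szy ?size_tuple// map_rcons.
have rotrE : [tuple of rotr 1 [tuple of x0 :: [tuple of x1 :: x]]] =
    [:: z, x0 & y] :> seq A.
  by rewrite /= lastI rotr1_rcons.
rewrite val_tup; last first.
  by rewrite /= lE size_rcons size_map size1_zip size_tuple ?szy.
rewrite !rotrE -tau_inv [_`_0]/= [drop _ _]/= drop1.
(* The product from [gamma_comul_iter] starts at the first entry of [l]; as [l] is nonempty,
   associativity lets any [p] be put in front. *)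
have foldl_head p : p ** foldl numul l`_0 (behead l) = foldl numul p l.
  rewrite -[RHS](_ : foldl numul p (l`_0 :: behead l) = _).
    elim: (behead l) (l`_0) => //= a s IHs b.
    by rewrite IHs numulA.
  by rewrite lE; case: [seq _ | _ <- _].
rewrite [_`_1]/= foldl_head lE foldl_rcons -act_prod_foldl -tau_trace.
by rewrite numul_act_prod.
Qed.

(** Terms match one by one: faces 0 to n give the contractions x^i x^{i+1}, the last face the term
    with x^{n+1} x^0. *)
Lemma gamma_hopf_b n (c : tpow H n) :
  gamma act tau n.+1 (hopf_b sigma c) = hoch_b (gamma act tau n c).
Proof.
apply/funext => x; rewrite /hoch_b /hopf_b linear_sum fct_sumE big_ord_recr/=.
congr (_ + _).
  apply: eq_bigr => i _; rewrite linearZ.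
  rewrite -[LHS]/((-1) ^+ i * gamma act tau n.+1 (face sigma n i c) x).
  by rewrite gamma_face// -ltnS.
rewrite linearZ.
rewrite -[LHS]/((-1) ^+ n.+1 * gamma act tau n.+1 (face sigma n n.+1 c) x).
by rewrite gamma_face_last.
Qed.

Lemma gamma_cyclic n (c : tpow H n) :
  c \in cyclic_elt delta sigma n -> gamma act tau n c \in cyclic_cochain A n.
Proof.
move=> /eqP c_cyc; apply/asboolP; split; first exact: gamma_multilinear.
by move=> x; rewrite -gamma_cyclic_op c_cyc linearZ.
Qed.

End Gamma.

(** * Maps induced on cohomology *)

Section InducedMap.
Variables (K : fieldType) (M N : nat -> lmodType K).
Variables (dM : forall n, {linear M n -> M n.+1}).
Variables (dN : forall n, {linear N n -> N n.+1}).
Variables (CM : forall n, submodClosed (M n)).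
Variables (CN : forall n, submodClosed (N n)).
Variable phi : forall n, {linear M n -> N n}.
Hypothesis phiC : forall n x, x \in CM n -> phi n x \in CN n.
Hypothesis phi_d : forall n x, x \in CM n -> phi n.+1 (dM n x) = dN n (phi n x).

Lemma phi_cocycle n (z : cocycles dM CM n) :
  phi n (val z) \in cocycle dN CN (n := n).
Proof.
case: z => z /= /andP[Cz /eqP dz]; apply/andP; split; first exact: phiC.
by rewrite -phi_d// dz linear0.
Qed.

Definition cocycle_map n (z : cocycles dM CM n) : cocycles dN CN n :=
  Sub (phi n (val z)) (phi_cocycle z).

Lemma cocycle_map_linear n : linear (@cocycle_map n).
Proof. by move=> a u v; apply/val_inj; rewrite !linearP/= linearP. Qed.

HB.instance Definition _ n := GRing.isLinear.Build K
  (cocycles dM CM n) (cocycles dN CN n) *:%R (@cocycle_map n)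
  (@cocycle_map_linear n).

Lemma cocycle_map_coboundary n (z : cocycles dM CM n) :
  z \in @coboundary K M dM CM n ->
  cocycle_map z \in @coboundary K N dN CN n.
Proof.
case: n z => [|n] z.
  move=> /eqP ->; apply/eqP/val_inj; exact: linear0.
move=> /asboolP[y Cy zy]; apply/asboolP; exists (phi n y); first exact: phiC.
by rewrite -phi_d// -zy.
Qed.

Definition cohomology_map n (q : cohomology dM CM n) : cohomology dN CN n :=
  coclass (cocycle_map (qrepr q)).

(** Two representatives of a class differ by a coboundary, which [cocycle_map] preserves, so the
    choice made by [qrepr] does not matter. *)
Lemma cohomology_map_class n (z : cocycles dM CM n) :
  cohomology_map (coclass z) = coclass (cocycle_map z).
Proof.
apply/qclassP; set y := qrepr _.
have : y - z \in @coboundary K M dM CM n by apply/qclassP; exact: qreprK.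
by move=> /cocycle_map_coboundary; rewrite linearB.
Qed.

Lemma cohomology_map_linear n : linear (@cohomology_map n).
Proof.
move=> a p q; rewrite -(qreprK p) -(qreprK q).
rewrite -[LHS]/(cohomology_map (a *: coclass (qrepr p) + coclass (qrepr q))).
rewrite -[RHS]/(a *: cohomology_map (coclass (qrepr p)) +
  cohomology_map (coclass (qrepr q))).
by rewrite /coclass -linearP !cohomology_map_class linearP [LHS]linearP.
Qed.

HB.instance Definition _ n := GRing.isLinear.Build K
  (cohomology dM CM n) (cohomology dN CN n) *:%R (@cohomology_map n)
  (@cohomology_map_linear n).

(** For uniqueness, every class has a cocycle representative, and [induced_by] prescribes the value
    there. *)
Lemma induced_map_exists_unique n :
  exists f : {linear cohomology dM CM n -> cohomology dN CN n},
    induced_by (phi n) f /\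
    forall g : {linear cohomology dM CM n -> cohomology dN CN n},
      induced_by (phi n) g -> g =1 f.
Proof.
exists (@cohomology_map n); split=> [z|g g_ind q].
  by exists (cocycle_map z) => //; exact: cohomology_map_class.
rewrite -(qreprK q); have [w wz gw] := g_ind (qrepr q).
rewrite [LHS]gw [RHS]cohomology_map_class; congr coclass.
exact: val_inj.
Qed.

End InducedMap.

Theorem proposition2 (R : realType) (H : hopfAlgType R[i])
    (delta : {lrmorphism H -> R[i]^o}) (sigma : H)
    (mpi : modular_pair_in_involution delta sigma)
    (A : nuAlgType R[i]) (act : {bilinear H -> A -> A})
    (act_action : is_action act)
    (tau : {scalar A})
    (tau_trace : sigma_trace act tau sigma)
    (tau_inv : delta_invariant act tau delta) :
  [/\ forall n (h : n.-tuple H) (x : n.+1.-tuple A),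
        gamma act tau n (pure h) x =
        tau (foldl (fun p hx => p ** act hx.1 hx.2)
               (thead x) (zip h (behead x))),
      forall n (c : tpow H n),
        c \in cyclic_elt delta sigma n ->
        gamma act tau n c \in cyclic_cochain A n,
      forall n (c : tpow H n),
        c \in cyclic_elt delta sigma n ->
        gamma act tau n.+1 (hopf_b sigma c) = hoch_b (gamma act tau n c) &
      forall n, exists f : {linear HC_hopf delta sigma n -> HC_alg A n},
        induced_by (gamma act tau n) f /\
        forall g : {linear HC_hopf delta sigma n -> HC_alg A n},
          induced_by (gamma act tau n) g -> g =1 f].
Proof.
have gammaC n (c : tpow H n) :=
  gamma_cyclic act_action tau_trace tau_inv (c := c).
have gamma_b n (c : tpow H n) :=
  gamma_hopf_b act_action tau_trace tau_inv c.
split=> [n h x|n c|n c _|n]; [|exact: gammaC|exact: gamma_b|].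
  by rewrite gamma_pure /thead (tnth_nth 0).
by apply: induced_map_exists_unique => // k x _; exact: gamma_b.
Qed.
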